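(* Let $(I,\mathscr{I},\nu)$ be a probability space and $\{C_i\}_{i\in I}$ a family of non-empty closed convex subsets of $\mathbb{R}^k$ such that $(i,x)\mapsto P_{C_i}(x)$ is measurable, where $P_{C_i}$ is the Euclidean projection onto $C_i$. Let $$C^\ast=\{x\in\mathbb{R}^k\colon x\in C_i \text{ for } \nu\text{-almost every } i\}$$ and assume $C^\ast\neq\emptyset$. Let $(\xi_n)$ be an ergodic stationary sequence of $I$-valued random variables with distribution $\nu$, let $\alpha\in(0,2)$, and for any $x_0\in\mathbb{R}^k$ define $X_0=x_0$, $X_{n+1}=X_n+\alpha\,(P_{C_{\xi_n}}(X_n)-X_n)$. Then $(X_n)$ converges almost surely to a random variable $X$ with $X\in C^\ast$ almost surely.
   Context: A sequence $(\xi_n)$ is ergodic stationary if its law on $I^{\mathbb{N}}$ is invariant and ergodic under the left shift. *)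

(* Defs.v *)
From HB Require Import structures.
From mathcomp Require Import all_boot all_order all_algebra.
From mathcomp Require Import all_classical all_reals all_analysis.
Set Implicit Arguments. Unset Strict Implicit. Unset Printing Implicit Defensive.
Import Order.TTheory GRing.Theory Num.Theory.
Local Open Scope classical_set_scope.
Local Open Scope ring_scope.

(* R^k is represented by row vectors 'rV[R^o]_k (topology: product topology). *)

Definition sqnorm (R : realType) (k : nat) (x : 'rV[R^o]_k) : R :=
  \sum_(j < k) (x ord0 j) ^+ 2.

Definition is_nearest (R : realType) (k : nat) (C : set 'rV[R^o]_k)
  (x p : 'rV[R^o]_k) : Prop :=
  C p /\ forall y, C y -> sqnorm (x - p) <= sqnorm (x - y).

(* Euclidean projection P_C(x) (unique for nonempty closed convex C) *)
Definition euclid_proj (R : realType) (k : nat) (C : set 'rV[R^o]_k)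
  (x : 'rV[R^o]_k) : 'rV[R^o]_k := xget x (is_nearest C x).

(* identification of R^k with the measurable space k.-tuple R
   (product = Borel sigma-algebra) *)
Definition tuple_of_rv (R : realType) (k : nat) (x : 'rV[R^o]_k) : k.-tuple R :=
  [tuple x ord0 j | j < k].
Definition rv_of_tuple (R : realType) (k : nat) (t : k.-tuple R) : 'rV[R^o]_k :=
  \row_(j < k) tnth t j.

Definition seq_measurable d (I : measurableType d) : set (set (nat -> I)) :=
  <<s \bigcup_(n in [set: nat])
        preimage_set_system [set: nat -> I] (fun f => f n) measurable >>.

Definition seq_shift {I : Type} (f : nat -> I) : nat -> I := fun n => f n.+1.

Definition path_of (Om I : Type) (xi : nat -> Om -> I) (w : Om) : nat -> I :=
  fun n => xi n w.

Definition stationary d dI (Om : measurableType d) (I : measurableType dI)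
  (R : realType) (Pr : probability Om R) (xi : nat -> Om -> I) : Prop :=
  forall B, @seq_measurable _ I B ->
    Pr (path_of xi @^-1` (@seq_shift I @^-1` B)) = Pr (path_of xi @^-1` B).

Definition ergodic d dI (Om : measurableType d) (I : measurableType dI)
  (R : realType) (Pr : probability Om R) (xi : nat -> Om -> I) : Prop :=
  forall B, @seq_measurable _ I B -> @seq_shift I @^-1` B = B ->
    Pr (path_of xi @^-1` B) = 0%E \/ Pr (path_of xi @^-1` B) = 1%E.

Definition Cstar d (I : measurableType d) (R : realType) (nu : probability I R)
  (k : nat) (C : I -> set 'rV[R^o]_k) : set 'rV[R^o]_k :=
  [set x | {ae nu, forall i, C i x}].

Fixpoint proj_iter (Om I : Type) (R : realType) (k : nat)
  (C : I -> set 'rV[R^o]_k) (alpha : R) (xi : nat -> Om -> I) (x0 : 'rV[R^o]_k)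
  (n : nat) (w : Om) : 'rV[R^o]_k :=
  match n with
  | 0 => x0
  | m.+1 => let y := proj_iter C alpha xi x0 m w in
            y + alpha *: (euclid_proj (C (xi m w)) y - y)
  end.

(* Main.v *)
(** The orbit is Fejer monotone with respect to every point of [C*]: its squared
    distance to such a point decreases at step [n] by at least
    [alpha * (2 - alpha)] times the squared gap between [X_n] and [C_(xi_n)].
    Hence the gaps and the steps tend to [0], and it suffices to find a limit point
    of the orbit in [C*], which then is the limit.

    A point outside [C*] lies in one of countably many balls whose centre [b] has a
    uniformly large gap to [C_i] for [i] in a set [A] of positive [nu]-measure.
    By ergodicity, for each [N] some window length [m] is such that the event "each
    of the first [N] sets [A] is visited during [n, ..., n + m - 1]" has positive
    probability, hence almost surely occurs for infinitely many [n]. No limit point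
    of the orbit along such window starts (with [N] growing) is in one of the balls,
    since the orbit barely moves during a window while its gaps tend to [0].
    The 0-1 law for invariant events suffices: no ergodic theorem is needed. *)

Require Import Defs.
From HB Require Import structures.
From mathcomp Require Import all_boot all_order all_algebra.
From mathcomp Require Import all_classical all_reals all_analysis.
From mathcomp Require Import measurable_realfun ring lra.
Import Order.TTheory GRing.Theory Num.Theory.
Import numFieldNormedType.Exports.
Local Open Scope classical_set_scope.
Local Open Scope ring_scope.

(** * Euclidean projections *)

Section euclidean_geometry.
Context {R : realType} {k : nat}.
Implicit Types (x y z p : 'rV[R^o]_k) (C : set 'rV[R^o]_k).

Definition dotv x y : R := \sum_(j < k) x ord0 j * y ord0 j.

Lemma sqnorm_ge0 x : 0 <= sqnorm x.
Proof. by apply: sumr_ge0 => j _; exact: sqr_ge0. Qed.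

Lemma sqnorm_eq0 x : sqnorm x = 0 -> x = 0.
Proof.
move=> /eqP; rewrite psumr_eq0 => [/allP h|j _]; last exact: sqr_ge0.
apply/rowP => j; rewrite mxE; have := h j (mem_index_enum _).
by rewrite sqrf_eq0 => /eqP.
Qed.

Lemma sqnorm0 : sqnorm (0 : 'rV[R^o]_k) = 0.
Proof. by rewrite /sqnorm big1// => j _; rewrite mxE expr0n. Qed.

Lemma sqnormN x : sqnorm (- x) = sqnorm x.
Proof. by apply: eq_bigr => j _; rewrite mxE sqrrN. Qed.

Lemma sqnormB x y : sqnorm (x - y) = sqnorm (y - x).
Proof. by rewrite -sqnormN opprB. Qed.

Lemma sqnormZ (a : R) x : sqnorm (a *: x) = a ^+ 2 * sqnorm x.
Proof. by rewrite /sqnorm big_distrr; apply: eq_bigr => j _; rewrite mxE exprMn. Qed.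

Lemma sqnorm_coord x j : (x ord0 j) ^+ 2 <= sqnorm x.
Proof.
rewrite /sqnorm (bigD1 j)//= lerDl; apply: sumr_ge0 => i _; exact: sqr_ge0.
Qed.

Lemma sqnormDZ (a : R) x y :
  sqnorm (x + a *: y) = sqnorm x + 2 * a * dotv x y + a ^+ 2 * sqnorm y.
Proof.
rewrite /sqnorm /dotv !big_distrr/= -!big_split/=; apply: eq_bigr => j _.
by rewrite !mxE /GRing.scale/=; ring.
Qed.

Lemma sqnormD_le x y : sqnorm (x + y) <= 2 * sqnorm x + 2 * sqnorm y.
Proof.
rewrite /sqnorm !big_distrr/= -big_split/=; apply: ler_sum => j _.
rewrite mxE; have := sqr_ge0 (x ord0 j - y ord0 j); nra.
Qed.

Lemma sqdist_le z x y : sqnorm (x - y) <= 2 * sqnorm (x - z) + 2 * sqnorm (z - y).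
Proof. by rewrite -[x - y](subrKA z); exact: sqnormD_le. Qed.

Lemma continuous_sqdist x : continuous (fun y => sqnorm (x - y)).
Proof.
apply: (@continuous_big R^o _ _ _ xpredT) => [|j _ y]; first exact: add_continuous.
have cj : {for y, continuous (fun z : 'rV[R^o]_k => (x ord0 j : R^o) - z ord0 j)}.
  by apply: continuousB; [exact: cst_continuous|exact: (@coord_continuous R 1 k ord0 j y)].
by under eq_fun do rewrite !mxE expr2; exact: (continuousM cj cj).
Qed.

Lemma compact_box (M : R) :
  compact [set x : 'rV[R^o]_k | forall j, `[- M, M]%classic (x ord0 j)].
Proof. by apply: (@rV_compact R^o k (fun=> `[- M, M]%classic)) => j; exact: segment_compact. Qed.

(** The half-width [M + 1] is a root-free bound for the square root of [M]. *)
Lemma sqnorm_le_box (M : R) x : sqnorm x <= M -> forall j, `[- (M + 1), M + 1]%classic (x ord0 j).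
Proof.
move=> xM j; have := sqnorm_coord x j.
by rewrite /= in_itv/= => xj; apply/andP; split; nra.
Qed.

(** Bolzano-Weierstrass, with arbitrarily late indices in place of a subsequence. *)
Lemma rV_bounded_cluster (u : nat -> 'rV[R^o]_k) (M : R) :
  (forall n, sqnorm (u n) <= M) ->
  exists x, forall e : R, 0 < e -> forall N,
    exists2 n, (N <= n)%N & sqnorm (x - u n) < e.
Proof.
move=> uM.
have [x [_ clx]] : [set x : 'rV[R^o]_k | forall j, `[- (M + 1), M + 1]%classic (x ord0 j)]
    `&` cluster (u @ \oo) !=set0.
  apply: (@compact_box (M + 1)).
  by exists 0%N => // n _; exact: sqnorm_le_box.
exists x => e e0 N.
have [] := clx [set u n | n in [set n | (N <= n)%N]] [set y | sqnorm (x - y) < e].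
- by exists N => // n Nn; exists n.
- have := @continuous_sqdist x x; rewrite /continuous_at subrr sqnorm0.
  move=> /cvgrPdist_lt /(_ e e0); apply: filterS => y.
  by rewrite sub0r normrN ger0_norm// sqnorm_ge0.
- by move=> y [[n Nn <-] xn]; exists n.
Qed.

(** Only points at least as close to [x] as a fixed [c] in [C] compete, and these lie in a compact
    box. *)
Lemma nearest_exists C x : C !=set0 -> closed C -> exists p, is_nearest C x p.
Proof.
move=> [c Cc] clC.
pose M := 2 * sqnorm x + 2 * sqnorm (x - c).
pose B := [set y : 'rV[R^o]_k | forall j, `[- (M + 1), M + 1]%classic (y ord0 j)].
have inB y : sqnorm (x - y) <= sqnorm (x - c) -> B y.
  move=> h; apply: sqnorm_le_box.
  have := sqdist_le x y 0; rewrite !subr0 sqnormB /M; lra.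
have [|||p] := @compact_EVT_min _ R (fun y => sqnorm (x - y)) (C `&` B).
- by exists c; split => //; exact: inB.
- by rewrite setIC; apply: compact_closedI => //; exact: compact_box.
- by apply: continuous_subspaceT; exact: continuous_sqdist.
rewrite inE => -[Cp Bp] pmin; exists p; split => // y Cy.
have [yc|/ltW cy] := leP (sqnorm (x - y)) (sqnorm (x - c)).
  by apply: pmin; rewrite inE; split => //; exact: inB.
by apply: le_trans cy; apply: pmin; rewrite inE; split => //; exact: inB.
Qed.

Lemma euclid_projP C x : C !=set0 -> closed C -> is_nearest C x (euclid_proj C x).
Proof.
by move=> C0 clC; rewrite /euclid_proj; have [p] := nearest_exists C x C0 clC; exact: xgetI.
Qed.

(** By convexity one may move from the projection a fraction [t] towards [z]. Minimality makes the
    resulting quadratic in [t] nonnegative on [0, 1], so its slope at 0 is not negative. *)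
Lemma euclid_proj_obtuse C x z :
  C !=set0 -> closed C -> convex_set (C : set (convex_lmodType 'rV[R^o]_k)) -> C z ->
  dotv (x - euclid_proj C x) (z - euclid_proj C x) <= 0.
Proof.
move=> C0 clC cvC Cz; have [Cp pmin] := euclid_projP C x C0 clC.
set p := euclid_proj C x in Cp pmin *.
have h (t : R) : 0 <= t -> t <= 1 ->
    0 <= - 2 * t * dotv (x - p) (z - p) + t ^+ 2 * sqnorm (z - p).
  move=> t0 t1.
  have Cq : C (p + t *: (z - p)).
    have -> : p + t *: (z - p) = t *: z + (1 - t) *: p.
      by rewrite scalerBr scalerBl scale1r addrCA.
    by have := cvC z p (Itv01 t0 t1); rewrite !inE => /(_ Cz Cp).
  have := pmin _ Cq; rewrite opprD addrA -scaleNr sqnormDZ sqrrN; lra.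
rewrite leNgt; apply/negP => d0.
set d := dotv _ _ in h d0; set s := sqnorm (z - p) in h.
have s0 : 0 <= s by exact: sqnorm_ge0.
(* Any [t] in (0, 1] with [t * s < 2 * d] is contradictory; this one has [t * s < d] and also covers
   [s = 0]. *)
have t0 : 0 < d / (d + s) by rewrite divr_gt0//; lra.
have t1 : d / (d + s) <= 1 by rewrite ler_pdivrMr; lra.
have := h _ (ltW t0) t1; set t := d / (d + s) in t0 t1 *.
have -> : - 2 * t * d + t ^+ 2 * s = t * (t * s - 2 * d) by ring.
rewrite pmulr_rge0// => ht.
have : t * s <= s * 1 by rewrite mulrC ler_wpM2l.
have : t * (d + s) = d by rewrite /t mulfVK//; lra.
nra.
Qed.

Definition sqgap C x : R := sqnorm (x - euclid_proj C x).

Lemma sqgap_ge0 C x : 0 <= sqgap C x.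
Proof. exact: sqnorm_ge0. Qed.

Lemma sqgap_eq0 C x : C !=set0 -> closed C -> sqgap C x = 0 <-> C x.
Proof.
move=> C0 clC; have [Cp pmin] := euclid_projP C x C0 clC; split.
  by move=> /sqnorm_eq0/eqP; rewrite subr_eq0 => /eqP ->.
move=> Cx; apply/eqP; rewrite eq_le sqgap_ge0 andbT.
by have := pmin _ Cx; rewrite subrr sqnorm0.
Qed.

(** The projection of [y] competes with that of [x]. *)
Lemma sqgap_le C x y : C !=set0 -> closed C ->
  sqgap C x <= 2 * sqnorm (x - y) + 2 * sqgap C y.
Proof.
move=> C0 clC; have [_ xmin] := euclid_projP C x C0 clC.
have [Cp _] := euclid_projP C y C0 clC.
exact: le_trans (xmin _ Cp) (sqdist_le _ _ _).
Qed.

(** Expanding the square, the obtuse angle at the projection bounds the cross term by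
    [- 2 * a * sqgap C y]; the quadratic term is [a ^+ 2 * sqgap C y]. *)
Lemma relaxed_proj_fejer C (a : R) y z :
  C !=set0 -> closed C -> convex_set (C : set (convex_lmodType 'rV[R^o]_k)) ->
  0 <= a -> C z ->
  sqnorm (y + a *: (euclid_proj C y - y) - z)
    <= sqnorm (y - z) - a * (2 - a) * sqgap C y.
Proof.
move=> C0 clC cvC a0 Cz; have := euclid_proj_obtuse C y z C0 clC cvC Cz.
rewrite /sqgap addrAC sqnormDZ; set p := euclid_proj C y => h.
have E : dotv (y - z) (p - y) = dotv (y - p) (z - p) - sqnorm (y - p).
  rewrite /dotv /sqnorm -sumrB; apply: eq_bigr => j _; rewrite !mxE; ring.
by rewrite E (sqnormB p); nra.
Qed.

Lemma cvg_sqdist (u : nat -> 'rV[R^o]_k) x :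
  (forall e : R, 0 < e -> exists N, forall n, (N <= n)%N -> sqnorm (u n - x) < e) ->
  u @ \oo --> x.
Proof.
move=> h; apply/cvg_ballP => e e0.
have [N hN] := h (e ^+ 2) (exprn_gt0 _ e0).
exists N => // n /= Nn; split => // i j; rewrite ord1 /ball/= -ltr_sqr ?nnegrE ?(ltW e0)//.
rewrite real_normK ?num_real//.
apply: le_lt_trans (hN n Nn); rewrite sqnormB.
by have := sqnorm_coord (x - u n) j; rewrite !mxE.
Qed.

End euclidean_geometry.

(** * Recurrence for ergodic sequences *)

Section sequence_space.
Context {dI : measure_display} {I : measurableType dI}.

Let G : set (set (nat -> I)) := \bigcup_(n in [set: nat])
  preimage_set_system [set: nat -> I] (fun f => f n) measurable.
Let T := g_sigma_algebraType G.

Lemma seq_measurable_coord n (A : set I) : measurable A ->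
  seq_measurable [set f | A (f n)].
Proof.
move=> mA; apply: sub_sigma_algebra; exists n => //; exists A => //.
by rewrite setTI.
Qed.

Lemma seq_measurable_bigcup (F : (set (nat -> I))^nat) (P : set nat) :
  (forall n, P n -> seq_measurable (F n)) ->
  seq_measurable (\bigcup_(n in P) F n).
Proof. exact: (@bigcup_measurable _ T). Qed.

Lemma seq_measurable_bigcap (F : (set (nat -> I))^nat) (P : set nat) :
  (forall n, P n -> seq_measurable (F n)) ->
  seq_measurable (\bigcap_(n in P) F n).
Proof. exact: (@bigcap_measurableType _ T). Qed.

Lemma seq_measurable_shift n (B : set (nat -> I)) : seq_measurable B ->
  seq_measurable (iter n seq_shift @^-1` B).
Proof.
move=> mB.
suff : measurable_fun [set: T] (iter n (@seq_shift I) : T -> T).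
  by move=> /(_ measurableT _ mB); rewrite setTI.
apply: (@measurability _ _ T T _ _ G) => // _ [_ [j _ [A mA <-]] <-].
rewrite !setTI (_ : iter n _ @^-1` _ = [set f | A (f (n + j)%N)]).
  exact: (seq_measurable_coord (n + j) _ mA).
apply/funext => f /=; congr A.
by elim: n j => //= n IH j; rewrite /seq_shift IH addnS addSn.
Qed.

Context {dO : measure_display} {Om : measurableType dO} (xi : nat -> Om -> I).
Hypothesis hxi : forall n, measurable_fun [set: Om] (xi n).

Lemma measurable_path (B : set (nat -> I)) : seq_measurable B ->
  measurable (path_of xi @^-1` B).
Proof.
move=> mB.
suff : measurable_fun [set: Om] (path_of xi : Om -> T).
  by move=> /(_ measurableT _ mB); rewrite setTI.
apply: (@measurability _ _ Om T _ _ G) => // _ [_ [j _ [A mA <-]] <-].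
by rewrite !setTI; have := hxi j measurableT _ mA; rewrite setTI.
Qed.

Context {R : realType} (Pr : probability Om R).
Hypotheses (hstat : stationary Pr xi) (herg : ergodic Pr xi).

Lemma probability_shift n (B : set (nat -> I)) : seq_measurable B ->
  Pr (path_of xi @^-1` (iter n seq_shift @^-1` B)) = Pr (path_of xi @^-1` B).
Proof.
elim: n B => //= n IH B mB.
rewrite -(hstat B mB); apply: (IH (seq_shift @^-1` B)).
exact: (seq_measurable_shift 1%N).
Qed.

(** That [B] occurs infinitely often is a shift-invariant event, so its probability is 0 or 1. By
    stationarity it is at least that of [B], which excludes 0. *)
Lemma ergodic_recurrence (B : set (nat -> I)) : seq_measurable B ->
  (0 < Pr (path_of xi @^-1` B))%E ->
  {ae Pr, forall w, forall n0, exists2 n, (n0 <= n)%N &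
    B (fun j => xi (n + j)%N w)}.
Proof.
move=> mB B0.
pose F n := iter n (@seq_shift I) @^-1` B.
have mF n : seq_measurable (F n) by exact: seq_measurable_shift.
have mL : seq_measurable (lim_sup_set F).
  by apply: seq_measurable_bigcap => n _; exact: seq_measurable_bigcup.
have invL : @seq_shift I @^-1` lim_sup_set F = lim_sup_set F.
  apply/seteqP; split => f /= Lf n _.
    have [j nj Fj] := Lf n Logic.I; exists j.+1; first exact: leqW.
    by move: Fj; rewrite /F /preimage/= -iterSr.
  have [[|j] //= nj Fj] := Lf n.+1 Logic.I; exists j => //.
  by rewrite /F /preimage /= -iterSr.
have pathL : path_of xi @^-1` lim_sup_set F = lim_sup_set (fun n => path_of xi @^-1` F n).
  by [].
have L1 : Pr (path_of xi @^-1` lim_sup_set F) = 1%E.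
  have [L0|//] := herg _ mL invL.
  suff : (Pr (path_of xi @^-1` B) <= 0)%E by rewrite leNgt B0.
  rewrite -L0 pathL.
  (* The tail unions decrease to the limit superior, and each contains a shift of [B], of the same
     probability as [B]. *)
  apply: cvge_ge (lim_sup_set_cvg Pr _ (fun n => measurable_path _ (mF n)) _); last first.
    apply: (@le_lt_trans _ _ 1%E); last exact: ltry.
    by apply: probability_le1; apply: bigcup_measurable => j _; exact: measurable_path.
  near=> n.
  rewrite -(probability_shift n B mB); apply: le_measure; rewrite ?inE.
  - exact: (measurable_path _ (mF n)).
  - by apply: bigcup_measurable => j _; exact: measurable_path.
  - by move=> w Fw; exists n => /=.
exists (~` (path_of xi @^-1` lim_sup_set F)); split.
- by apply: measurableC; exact: measurable_path.
- by rewrite probability_setC ?L1 ?subee//; exact: measurable_path.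
apply: subsetC => w /= Lw n0; have [n nn Bn] := Lw n0 Logic.I; exists n => //.
move: Bn; rewrite /F/= (_ : iter n _ _ = fun j => xi (n + j)%N w)//.
apply/funext => j; elim: n j {nn} => //= n IH j.
by rewrite /seq_shift IH addnS addSn.
Unshelve. all: by end_near. Qed.

(** By recurrence almost every path visits every [A l], hence lies in some [W m]. So some [W m] has
    positive probability, and recurrence applies to it in turn. *)
Lemma ergodic_windows (A : nat -> set I) : (forall l, measurable (A l)) ->
  (forall l, 0 < Pr (xi 0%N @^-1` A l))%E ->
  {ae Pr, forall w, forall N, exists m, forall n0, exists2 n, (n0 <= n)%N &
    forall l, (l < N)%N -> exists2 j, (j < m)%N & A l (xi (n + j)%N w)}.
Proof.
move=> mA A0; apply: ae_foralln => N.
pose W m := \bigcap_(l in [set l | (l < N)%N])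
  \bigcup_(j in [set j | (j < m)%N]) [set f : nat -> I | A l (f j)].
have mW m : seq_measurable (W m).
  apply: seq_measurable_bigcap => l _; apply: seq_measurable_bigcup => j _.
  exact: seq_measurable_coord.
have visit : {ae Pr, forall w, forall l, exists j, A l (xi j w)}.
  apply: ae_foralln => l.
  have := ergodic_recurrence [set f | A l (f 0%N)] (seq_measurable_coord 0%N _ (mA l)) (A0 l).
  by apply: filterS => w /(_ 0%N)[n _ /=]; exists (n + 0)%N.
have [m Wm] : exists m, (0 < Pr (path_of xi @^-1` W m))%E.
  apply: contrapT => /forallNP noW.
  have W0 : Pr.-negligible (\bigcup_m (path_of xi @^-1` W m)).
    apply: negligible_bigcup => m; exists (path_of xi @^-1` W m); split => //.
      exact: measurable_path.
    by apply/eqP; rewrite -measure_le0 leNgt; exact/negP/noW.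
  have : {ae Pr, forall w, False}.
    have nW : {ae Pr, forall w, ~ (\bigcup_m (path_of xi @^-1` W m)) w}.
      by apply: negligibleS W0 => w /= /contrapT.
    move: nW visit; apply: filterS2 => w nw v; apply: nw.
    have {v}/choice[f hf] := v.
    exists (\max_(l < N) (f l).+1) => // l lN /=; exists (f l) => //=.
    exact: (leq_bigmax (Ordinal lN)).
  move=> h; have /(measure_negligible measurableT) : Pr.-negligible [set: Om].
    by apply: negligibleS h => w _ [].
  by move=> P0; have /eqP := probability_setT Pr; rewrite [X in X == _]P0 eq_sym onee_eq0.
have := ergodic_recurrence (W m) (mW m) Wm; apply: filterS => w h; exists m => n0.
by have [n nn Wn] := h n0; exists n.
Qed.

End sequence_space.

(** * Orbits of relaxed projections *)

Section relaxed_projection_orbit.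
Context {R : realType} {k : nat} (D : nat -> set 'rV[R^o]_k) (alpha : R)
  (X : nat -> 'rV[R^o]_k).
Hypotheses (D0 : forall n, D n !=set0) (clD : forall n, closed (D n))
  (cvD : forall n, convex_set (D n : set (convex_lmodType 'rV[R^o]_k)))
  (alpha02 : 0 < alpha < 2)
  (XS : forall n, X n.+1 = X n + alpha *: (euclid_proj (D n) (X n) - X n)).

Lemma orbit_fejer z n : D n z ->
  sqnorm (X n.+1 - z) <= sqnorm (X n - z) - alpha * (2 - alpha) * sqgap (D n) (X n).
Proof.
by move=> Dz; rewrite XS; apply: relaxed_proj_fejer => //; case/andP: alpha02 => /ltW.
Qed.

Let c_gt0 : 0 < alpha * (2 - alpha).
Proof. by case/andP: alpha02 => a0 a2; rewrite mulr_gt0// subr_gt0. Qed.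

Lemma orbit_nonincreasing z m n : (forall n, D n z) -> (m <= n)%N ->
  sqnorm (X n - z) <= sqnorm (X m - z).
Proof.
move=> Dz /subnK <-; elim: (n - m)%N => // p IH; rewrite addSn.
apply: le_trans IH; apply: le_trans (orbit_fejer _ _ (Dz _)) _.
by rewrite gerBl mulr_ge0 ?sqgap_ge0// ltW.
Qed.

(** The squared distances to [z] do not increase. Once one is within [alpha * (2 - alpha) * e] of
    their infimum, every later decrease is smaller than that. *)
Lemma orbit_gap_small z (e : R) : (forall n, D n z) -> 0 < e ->
  exists N, forall n, (N <= n)%N -> sqgap (D n) (X n) < e.
Proof.
move=> Dz e0; pose a := [set sqnorm (X n - z) | n in [set: nat]].
have a_inf : has_inf a.
  split; first by exists (sqnorm (X 0%N - z)), 0%N.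
  by exists 0 => _ [n _ <-]; exact: sqnorm_ge0.
have [_ [N _ <-] aN] := inf_adherent (mulr_gt0 c_gt0 e0) a_inf.
exists N => n Nn; rewrite -(ltr_pM2l c_gt0).
have := orbit_nonincreasing z _ _ Dz Nn; have := orbit_fejer _ _ (Dz n).
have : inf a <= sqnorm (X n.+1 - z) by apply: ge_inf; [exact: a_inf.2|exists n.+1].
lra.
Qed.

Lemma orbit_drift_small z m (e : R) : (forall n, D n z) -> 0 < e ->
  exists N, forall n j, (N <= n)%N -> (j < m)%N -> sqnorm (X (n + j) - X n) < e.
Proof.
move=> Dz; elim: m e => [|m IH] e e0; first by exists 0%N.
(* The total is [e]: [2 * (e / 4)] from the earlier drift and [2 * 4 * (e / 16)] from the last step,
   as [alpha ^+ 2 <= 4]. *)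
have [N1 h1] := IH (e / 4) ltac:(lra).
have [N2 h2] := orbit_gap_small z (e / 16) Dz ltac:(lra).
exists (maxn N1 N2) => n j; rewrite geq_max => /andP[n1 n2].
case: j => [_|j]; first by rewrite addn0 subrr sqnorm0.
rewrite ltnS => jm.
have := h1 n j n1 jm; have := h2 (n + j)%N (leq_trans n2 (leq_addr _ _)).
have := sqdist_le (X (n + j)) (X (n + j.+1)) (X n).
rewrite addnS XS [_ + _ *: _ - X (n + j)]addrC addKr sqnormZ (sqnormB _ (X (n + j))).
rewrite -/(sqgap _ _) => h g d; apply: le_lt_trans h _.
have : alpha ^+ 2 * sqgap (D (n + j)) (X (n + j)) <= 4 * sqgap (D (n + j)) (X (n + j)).
  by apply: ler_wpM2r; [exact: sqgap_ge0|case/andP: alpha02; nra].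
lra.
Qed.

(** The distance to [x] never increases, so close once means close ever after. *)
Lemma orbit_cvg x : (forall n, D n x) ->
  (forall e : R, 0 < e -> exists n, sqnorm (X n - x) < e) -> X @ \oo --> x.
Proof.
move=> Dx h; apply: cvg_sqdist => e /h[N XN]; exists N => n Nn.
exact: le_lt_trans (orbit_nonincreasing x _ _ Dx Nn) XN.
Qed.

(** [A l n] stands for a visit to the [l]-th set at time [n], and [x] is a limit point along window
    starts. If [x] is in the [l]-th ball, a late window has such a visit while the orbit is still
    near [x] with a small gap, which bounds the gap at [b l]. *)
Lemma orbit_window_cluster z (A : nat -> nat -> Prop) (b : nat -> 'rV[R^o]_k) (r : nat -> R) :
  (forall n, D n z) -> (forall l, 0 < r l) ->
  (forall N, exists m, forall n0, exists2 n, (n0 <= n)%N &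
    forall l, (l < N)%N -> exists2 j, (j < m)%N & A l (n + j)%N) ->
  exists x, (forall e : R, 0 < e -> exists n, sqnorm (X n - x) < e) /\
    forall l, sqnorm (x - b l) < r l ->
      exists2 n, A l n & sqgap (D n) (b l) <= 9 * r l.
Proof.
move=> Dz r0 hA.
(* [t N] starts a window visiting the first [N] sets, so late that drift and gaps inside it are
   below [N.+1%:R^-1]. *)
have /choice[t ht] : forall N, exists n, exists2 m,
    forall l, (l < N)%N -> exists2 j, (j < m)%N & A l (n + j)%N &
    forall j, (j < m)%N -> sqnorm (X (n + j) - X n) < N.+1%:R^-1 /\
      sqgap (D (n + j)%N) (X (n + j)) < N.+1%:R^-1.
  move=> N; have [m hm] := hA N.
  have N0 : (0 : R) < N.+1%:R^-1 by rewrite invr_gt0.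
  have [N1 h1] := orbit_drift_small z m _ Dz N0.
  have [N2 h2] := orbit_gap_small z _ Dz N0.
  have [n] := hm (maxn N1 N2); rewrite geq_max => /andP[n1 n2] hn.
  exists n, m => // j jm; split; first exact: h1.
  by apply: h2; exact: leq_trans n2 (leq_addr _ _).
have [n|x hx] := rV_bounded_cluster (X \o t) (2 * sqnorm (X 0%N - z) + 2 * sqnorm z).
  have /= := sqdist_le z (X (t n)) 0; rewrite !subr0.
  have := orbit_nonincreasing z _ _ Dz (leq0n (t n)); lra.
exists x; split => [e e0|l xl].
  by have [n _] := hx e e0 0%N; exists (t n); rewrite sqnormB.
have [N hN] : exists N, forall n, (N <= n)%N -> n.+1%:R^-1 < r l / 16.
  have rl : 0 < r l / 16 by rewrite divr_gt0.
  exists (Num.truncn (r l / 16)^-1) => n Nn.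
  rewrite invf_plt ?posrE//; apply: lt_le_trans (truncnS_gt _) _.
  by rewrite ler_nat ltnS.
(* From [N] on the tolerance holds; from [l.+1] on the window visits [A l]. *)
have [n] := hx (r l / 16) ltac:(by rewrite divr_gt0) (maxn N l.+1).
rewrite geq_max => /andP[Nn ln] /= xn.
have [m Am sm] := ht n; have [j jm Aj] := Am l ln; have [dj gj] := sm j jm.
have {}dj := lt_trans dj (hN n Nn); have {}gj := lt_trans gj (hN n Nn).
have rl := r0 l.
exists (t n + j)%N => //.
(* Three doublings turn the distance from [x] to [b l] into [8 * r l]; the errors of [r l / 16]
   enter with total weight 14, which stays below [9 * r l]. *)
have := sqgap_le _ (b l) (X (t n + j)%N) (D0 (t n + j)) (clD (t n + j)).
have := sqdist_le (X (t n)) (b l) (X (t n + j)).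
have := sqdist_le x (b l) (X (t n)).
move: xl dj; rewrite (sqnormB x (b l)) (sqnormB (X (t n + j))); lra.
Qed.

End relaxed_projection_orbit.

(** * Random projections *)

Section rational_balls.
Context {R : realType} {k : nat}.

Lemma rV_rat_dense (x : 'rV[R^o]_k) (e : R) : 0 < e ->
  exists q : 'rV[rat]_k, sqnorm (x - map_mx ratr q) < e.
Proof.
(* As [d <= 1], an error below [d] has square at most [d]. The divisor [k.+1] makes the sum of [k]
   squares strictly less than [e], also for [k = 0]. *)
move=> e0; pose d := Order.min 1 (e / k.+1%:R).
have ek0 : 0 < e / k.+1%:R by rewrite divr_gt0.
have d0 : 0 < d by rewrite lt_min ltr01.
have d1 : d <= 1 by rewrite ge_min lexx.
have de : d <= e / k.+1%:R by rewrite ge_min lexx orbT.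
have /choice[q hq] : forall j : 'I_k, exists q : rat, (x ord0 j - ratr q) ^+ 2 <= d.
  move=> j; have [|q] := @rat_in_itvoo R (x ord0 j) (x ord0 j + d); first by rewrite ltrDl.
  rewrite in_itv/= => /andP[q1 q2]; exists q; nra.
exists (\row_j q j).
apply: (@le_lt_trans _ _ (\sum_(j < k) e / k.+1%:R)).
  by apply: ler_sum => j _; rewrite !mxE; exact: le_trans (hq j) de.
rewrite sumr_const card_ord -[_ *+ k]mulr_natr mulrAC ltr_pdivrMr// ltr_pM2l//.
by rewrite ltr_nat.
Qed.

Lemma rational_balls : exists (b : nat -> 'rV[R^o]_k) (r : nat -> R),
  (forall l, 0 < r l) /\
  forall x e, 0 < e -> exists2 l, r l < e & sqnorm (x - b l) < r l.
Proof.
pose T : countType := ('rV[rat]_k * nat)%type.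
(* A code [l] without a preimage yields the ball around 0 with [r l = 1], which is still
   admissible. *)
pose D l : T := odflt (0, 0%N) (unpickle l).
exists (fun l => map_mx ratr (D l).1), (fun l => (D l).2.+1%:R^-1).
split=> [l|x e e0]; first by rewrite invr_gt0.
have [n ne] : exists n : nat, n.+1%:R^-1 < e.
  exists (Num.truncn e^-1).
  by rewrite invf_plt ?posrE//; exact: truncnS_gt.
have [q xq] := rV_rat_dense x n.+1%:R^-1 ltac:(by rewrite invr_gt0).
by exists (pickle ((q, n) : T)); rewrite /D pickleK.
Qed.

End rational_balls.

Section random_projections.
Context {R : realType} {k : nat} {dI : measure_display} {I : measurableType dI}
  (nu : probability I R) (C : I -> set 'rV[R^o]_k).
Hypotheses (hCne : forall i, C i !=set0) (hCcl : forall i, closed (C i))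
  (hPmeas : measurable_fun [set: I * k.-tuple R]
     (fun p => tuple_of_rv (euclid_proj (C p.1) (rv_of_tuple p.2)))).

Lemma tuple_of_rvK (x : 'rV[R^o]_k) : rv_of_tuple (tuple_of_rv x) = x.
Proof. by apply/rowP => j; rewrite mxE tnth_mktuple. Qed.

Lemma measurable_tuple_of_rvP {d} {T : measurableType d} (f : T -> 'rV[R^o]_k) :
  measurable_fun [set: T] (fun t => tuple_of_rv (f t)) <->
  forall j, measurable_fun [set: T] (fun t => f t ord0 j : R).
Proof.
have E j : (tnth (T:=R))^~ j \o (fun t => tuple_of_rv (f t)) = fun t => f t ord0 j.
  by apply/funext => t /=; rewrite tnth_mktuple.
split=> [/measurable_fun_tnthP h j|h]; first by have := h j; rewrite E.
by apply/measurable_fun_tnthP => j; rewrite E.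
Qed.

Lemma measurable_euclid_proj {d} {T : measurableType d} (i : T -> I) (f : T -> 'rV[R^o]_k) :
  measurable_fun [set: T] i -> measurable_fun [set: T] (fun t => tuple_of_rv (f t)) ->
  measurable_fun [set: T] (fun t => tuple_of_rv (euclid_proj (C (i t)) (f t))).
Proof.
move=> mi mf.
have := measurableT_comp hPmeas (measurable_fun_pair mi mf).
by congr (measurable_fun _ _); apply/funext => t /=; rewrite tuple_of_rvK.
Qed.

Lemma measurable_sqgap x : measurable_fun [set: I] (fun i => sqgap (C i) x).
Proof.
rewrite /sqgap /sqnorm; apply: measurable_sum => j.
apply: measurable_funX; under eq_fun do rewrite !mxE.
apply: measurable_funB; first exact: measurable_cst.
apply: (measurable_tuple_of_rvP _).1.
by apply: (measurable_euclid_proj id (fun=> x)) => //; exact: measurable_cst.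
Qed.

Lemma measurable_sqgap_gt x (c : R) : measurable [set i | c < sqgap (C i) x].
Proof.
have := measurable_sqgap x measurableT _ (measurable_itv `]c, +oo[).
by rewrite setTI; congr measurable; apply/funext => i /=; rewrite in_itv/= andbT.
Qed.

(** A positive gap exceeds some [n.+1%:R^-1]; if all these countably many events were null, almost
    every [C i] would contain [x]. *)
Lemma notin_Cstar_gap x : ~ Cstar nu C x ->
  exists2 e : R, 0 < e & (0 < nu [set i | (e < sqgap (C i) x)%R])%E.
Proof.
move=> nx; apply: contrapT => h; apply: nx.
have : {ae nu, forall i, forall n, sqgap (C i) x <= n.+1%:R^-1}.
  apply: ae_foralln => n; exists [set i | n.+1%:R^-1 < sqgap (C i) x]; split.
  - exact: measurable_sqgap_gt.
  - apply/eqP; rewrite -measure_le0 leNgt; apply/negP => h0; apply: h.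
    by exists n.+1%:R^-1 => //; rewrite invr_gt0.
  - by move=> i /= /negP; rewrite -ltNge.
apply: filterS => i hi; apply/(sqgap_eq0 _ _ (hCne i) (hCcl i)).
apply/eqP; rewrite eq_le sqgap_ge0 andbT leNgt; apply/negP => g0.
have := hi (Num.truncn (sqgap (C i) x)^-1); rewrite leNgt invf_plt ?posrE//.
by rewrite truncnS_gt.
Qed.

Context {dO : measure_display} {Om : measurableType dO} (Pr : probability Om R)
  (xi : nat -> Om -> I).
Hypotheses (hxi : forall n, measurable_fun [set: Om] (xi n))
  (hlaw : forall n A, measurable A -> Pr (xi n @^-1` A) = nu A).

Lemma ae_law (P : I -> Prop) n : {ae nu, forall i, P i} -> {ae Pr, forall w, P (xi n w)}.
Proof.
move=> [N [mN N0 PN]]; exists (xi n @^-1` N); split.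
- by have := hxi n measurableT _ mN; rewrite setTI.
- by rewrite hlaw.
- by move=> w /= Pw; exact: PN.
Qed.

(** The exceptional null set of a single [z] depends on [z]. One point of [Cstar nu C] is therefore
    fixed in each rational ball that meets it, and closedness of the [C i] extends the inclusion
    from these countably many points. *)
Lemma ae_Cstar_subset :
  {ae Pr, forall w, forall n z, Cstar nu C z -> C (xi n w) z}.
Proof.
have [b [r [r0 br]]] := @rational_balls R k.
pose Q l z := Cstar nu C z /\ sqnorm (z - b l) < r l.
have : {ae Pr, forall w, forall l n, (exists z, Q l z) -> C (xi n w) (xget 0 (Q l))}.
  apply: ae_foralln => l; apply: ae_foralln => n.
  have [[z Qz]|noQ] := pselect (exists z, Q l z); last by apply: nearW => w /noQ.
  have [Cz _] : Q l (xget 0 (Q l)) by exact: xgetI Qz.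
  by have := ae_law _ n Cz; apply: filterS.
apply: filterS => w h n z Cz.
apply/(sqgap_eq0 _ _ (hCne _) (hCcl _)); apply/eqP; rewrite eq_le sqgap_ge0 andbT.
apply/ler_addgt0Pl => e e0; rewrite addr0.
(* Two points of the ball are at squared distance below [4 * r l], so the gap at [z] is below
   [8 * r l < e]. *)
have [l rl zl] := br z (e / 8) ltac:(by rewrite divr_gt0).
have Qz : Q l z by [].
have [_ bl] : Q l (xget 0 (Q l)) by exact: xgetI Qz.
have /(sqgap_eq0 _ _ (hCne _) (hCcl _)) g0 := h l n (ex_intro _ z Qz).
have := sqgap_le (C (xi n w)) z (xget 0 (Q l)) (hCne _) (hCcl _).
have := sqdist_le (b l) z (xget 0 (Q l)).
move: bl; rewrite (sqnormB _ (b l)) g0; lra.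
Qed.

Lemma measurable_proj_iter alpha x0 n :
  measurable_fun [set: Om] (fun w => tuple_of_rv (proj_iter C alpha xi x0 n w)).
Proof.
elim: n => [|n IH]; first exact: (measurable_cst (tuple_of_rv x0)).
apply/measurable_tuple_of_rvP => j.
have := (measurable_tuple_of_rvP _).1 (measurable_euclid_proj _ _ (hxi n) IH) j.
have := (measurable_tuple_of_rvP _).1 IH j => mX mP.
rewrite /=; under eq_fun do rewrite !mxE.
apply: measurable_funD => //; apply: measurable_funM; first exact: measurable_cst.
exact: measurable_funB.
Qed.

End random_projections.

(** The coordinatewise limit superior is measurable, is defined everywhere, and equals the limit
    wherever one exists. *)
Lemma measurable_rv_limit {R : realType} {k : nat} {d} {T : measurableType d}
    (X : nat -> T -> 'rV[R^o]_k) :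
  (forall n, measurable_fun [set: T] (fun t => tuple_of_rv (X n t))) ->
  exists2 Y : T -> 'rV[R^o]_k, measurable_fun [set: T] (fun t => tuple_of_rv (Y t)) &
    forall t x, (fun n => X n t) @ \oo --> x -> Y t = x.
Proof.
move=> mX.
exists (fun t => \row_j fine (limn_esup (fun n => (X n t ord0 j : R)%:E))).
  apply/measurable_tuple_of_rvP => j; under eq_fun do rewrite mxE.
  apply: measurableT_comp => //; apply: measurable_fun_limn_esup => n.
  by apply/measurable_EFinP; apply: (measurable_tuple_of_rvP _).1.
move=> t x Xx; apply/rowP => j; rewrite mxE.
have Xj : (fun n => X n t ord0 j) @ \oo --> (x ord0 j : R^o).
  exact: (cvg_comp _ _ Xx (@coord_continuous R 1 k ord0 j x)).
have : (fun n => (X n t ord0 j : R)%:E) @ \oo --> (x ord0 j : R)%:E.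
  by apply: cvg_EFin; [exact: nearW|exact: Xj].
by move=> /cvg_limn_einf_sup[_ ->].
Qed.

Theorem theoremC (R : realType) (k : nat)
  (dI : measure_display) (I : measurableType dI) (nu : probability I R)
  (C : I -> set 'rV[R^o]_k)
  (hCne : forall i, C i !=set0)
  (hCcl : forall i, closed (C i))
  (hCcv : forall i, convex_set (C i : set (convex_lmodType 'rV[R^o]_k)))
  (hPmeas : measurable_fun [set: I * k.-tuple R]
     (fun p => tuple_of_rv (euclid_proj (C p.1) (rv_of_tuple p.2))))
  (hCstar : Cstar nu C !=set0)
  (dO : measure_display) (Om : measurableType dO) (Pr : probability Om R)
  (xi : nat -> Om -> I)
  (hxi : forall n, measurable_fun [set: Om] (xi n))
  (hlaw : forall n A, measurable A -> Pr (xi n @^-1` A) = nu A)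
  (hstat : stationary Pr xi) (herg : ergodic Pr xi)
  (alpha : R) (halpha : 0 < alpha < 2) (x0 : 'rV[R^o]_k) :
  exists X : Om -> 'rV[R^o]_k,
    measurable_fun [set: Om] (fun w => tuple_of_rv (X w)) /\
    {ae Pr, forall w, (fun n => proj_iter C alpha xi x0 n w) @ \oo --> X w} /\
    {ae Pr, forall w, Cstar nu C (X w)}.
Proof.
have [X mX limX] := measurable_rv_limit _
  (measurable_proj_iter C hPmeas xi hxi alpha x0).
exists X; split => //.
suff : {ae Pr, forall w, exists2 x, Cstar nu C x &
    (fun n => proj_iter C alpha xi x0 n w) @ \oo --> x}.
  move=> h; split; move: h; apply: filterS => w [x Cx Xx].
    by rewrite (limX w x).
  by rewrite (limX w x).
have [b [r [r0 br]]] := @rational_balls R k.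
(* The threshold [9 * r l] is the bound of [orbit_window_cluster], which a visit to [bad l]
   violates. *)
pose bad l := [set i | 9 * r l < sqgap (C i) (b l)].
(* the other balls are assigned the whole space so that every [A l] has positive measure *)
pose A l := if (0 < nu (bad l))%E then bad l else setT.
have mA l : measurable (A l).
  by rewrite /A; case: ifP => // _; exact: measurable_sqgap_gt.
have A0 l : (0 < Pr (xi 0%N @^-1` A l))%E.
  by rewrite hlaw// /A; case: ifP => // _; rewrite probability_setT.
have subC := ae_Cstar_subset nu C hCne hCcl Pr xi hxi hlaw.
have win := ergodic_windows xi hxi Pr hstat herg A mA A0.
have [z Cz] := hCstar.
move: subC win; apply: filterS2 => w subC win.
pose D n := C (xi n w); pose Y n := proj_iter C alpha xi x0 n w.
have D0 n : D n !=set0 by exact: hCne.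
have clD n : closed (D n) by exact: hCcl.
have cvD n : convex_set (D n : set (convex_lmodType 'rV[R^o]_k)) by exact: hCcv.
have YS n : Y n.+1 = Y n + alpha *: (euclid_proj (D n) (Y n) - Y n) by [].
have [x [clx hx]] := orbit_window_cluster D alpha Y D0 clD cvD halpha YS z
  (fun l n => A l (xi n w)) b r (fun n => subC n z Cz) r0 win.
have Cx : Cstar nu C x.
  apply: contrapT => /(notin_Cstar_gap nu C hCne hCcl hPmeas)[e e0 ge].
  (* If the gap at [x] exceeds [e > 20 * r l], the gap at [b l] exceeds [e / 2 - r l > 9 * r l]. So
     [bad l] contains a set of positive measure. *)
  have [l rl xl] := br x (e / 20) ltac:(by rewrite divr_gt0).
  have bad0 : (0 < nu (bad l))%E.
    apply: lt_le_trans ge _; apply: le_measure; rewrite ?inE; try exact: measurable_sqgap_gt.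
    move=> i /= gi; have := sqgap_le (C i) x (b l) (hCne i) (hCcl i); rewrite /bad/=; lra.
  have [n An gn] := hx l xl; move: An.
  by rewrite /A bad0 /bad/= ltNge gn.
by exists x => //; apply: (orbit_cvg D alpha Y D0 clD cvD halpha YS) => // n; exact: subC.
Qed.
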